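(* Let $s$ be any integer and $m$ a positive integer, and let $\alpha=(1+\sqrt5)/2$. Then \[ \sum_{j = 1}^\infty \frac{H_m (j)}{j^2 \binom{2j}j}F_{2j + s} = \frac{1}{(2m)!}\left( \frac{\pi }{10} \right)^{2m} \frac{1}{\sqrt 5 }\left((3^{2m} + 1)\alpha ^s - L_s \right), \qquad \sum_{j = 1}^\infty \frac{H_m (j)}{j^2 \binom{2j}j}L_{2j + s} = \frac{1}{(2m)!}\left( \frac{\pi }{10} \right)^{2m} \left((3^{2m} - 1)\alpha ^s + L_s \right). \]
   Context: $F_j$ and $L_j$ denote the Fibonacci and Lucas numbers, defined for all integers $j$ by $F_0=0$, $F_1=1$, $L_0=2$, $L_1=1$, $F_j=F_{j-1}+F_{j-2}$, $L_j=L_{j-1}+L_{j-2}$, extended to negative indices by $F_{-j}=(-1)^{j-1}F_j$, $L_{-j}=(-1)^jL_j$; equivalently $F_j=(\alpha^j-\beta^j)/\sqrt5$, $L_j=\alpha^j+\beta^j$ with $\beta=(1-\sqrt5)/2$. For positive integers $j$, $H_1(j)=1/4$ and, for $m\ge1$, \[ H_{m + 1} (j) = \frac{1}{4}\sum_{n_1 = 1}^{j - 1} \frac{1}{(2n_1 )^2 }\sum_{n_2 = 1}^{n_1 - 1} \frac{1}{(2n_2 )^2 } \cdots \sum_{n_m = 1}^{n_{m - 1} - 1} \frac{1}{(2n_m )^2 }, \] with empty sums equal to zero. *)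

(* Defs.v *)
From Stdlib Require Import Reals ZArith.
From Coquelicot Require Import Coquelicot.

Fixpoint fib (n : nat) : Z :=
  match n with
  | O => 0
  | S k => match k with O => 1 | S l => fib k + fib l end
  end%Z.

Fixpoint luc (n : nat) : Z :=
  match n with
  | O => 2
  | S k => match k with O => 1 | S l => luc k + luc l end
  end%Z.

Definition fibZ (j : Z) : Z :=
  match j with
  | Zneg p => (- 1) ^ (Zpos p - 1) * fib (Pos.to_nat p)
  | _ => fib (Z.to_nat j)
  end%Z.

Definition lucZ (j : Z) : Z :=
  match j with
  | Zneg p => (- 1) ^ Zpos p * luc (Pos.to_nat p)
  | _ => luc (Z.to_nat j)
  end%Z.

Open Scope R_scope.

Definition alpha : R := (1 + sqrt 5) / 2.

(* The m-fold nested sum over  n > n_1 > ... > n_m >= 1  of the products of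
   1 / (2 n_i)^2;  [sum_n_m a 1 (n - 1)] is zero when [n <= 1]. *)
Fixpoint nested_sum (m n : nat) : R :=
  match m with
  | O => 1
  | S k =>
      sum_n_m (fun i : nat => 1 / (2 * INR i) ^ 2 * nested_sum k i) 1 (n - 1)
  end.

(* [H m j] is H_m(j) for m >= 1; the value at m = 0 is junk. *)
Definition H (m j : nat) : R :=
  match m with
  | O => 0
  | S k => 1 / 4 * nested_sum k j
  end.

Definition coeff (m j : nat) : R :=
  H m j / (INR j ^ 2 * Binomial.C (2 * j) j).

(* Main.v *)
Require Import Defs.
From Stdlib Require Import Reals ZArith Lra Lia.
From Coquelicot Require Import Coquelicot.
Open Scope R_scope.

(** Put [w = 4 sin^2 t].  The recurrences for the central binomial coefficients
    and for the nested sums say that [g_m(t) := sum_j H_m(j) w^j / (j^2 C(2j,j))]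
    satisfies [g_(m+1)'' = g_m], [g_0 = 1] and [g_m(0) = g_m'(0) = 0] for
    [m >= 1]; hence [g_m(t) = t^(2m) / (2m)!] for [0 <= t < PI/2].  As
    [2 sin (3 PI / 10) = alpha] and [2 sin (PI / 10) = - beta], the values of
    [g_m] at these two points combine through Binet's formulas. *)

(** * Nested sums and central binomial coefficients *)

Lemma nested_sum_succ (m j : nat) :
  nested_sum (S m) (S (S j)) =
  nested_sum (S m) (S j) + 1 / (2 * INR (S j)) ^ 2 * nested_sum m (S j).
Proof.
  cbn [nested_sum].
  replace (S (S j) - 1)%nat with (S j) by lia.
  replace (S j - 1)%nat with j by lia.
  now rewrite sum_n_Sm by lia.
Qed.

Lemma nested_sum_1 (m : nat) : nested_sum (S m) 1 = 0.
Proof.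
  cbn [nested_sum]. apply (sum_n_m_zero (G := R_AbelianMonoid)); lia.
Qed.

Lemma nested_sum_bounds (m n : nat) : 0 <= nested_sum m (S n) <= 1.
Proof.
  revert n; induction m as [|m IHm]; intros n; [simpl; lra|].
  (* The sharper bound makes the induction on [n] telescope: the terms of the outer sum satisfy
     [1 / (2 * k) ^ 2 <= 1 / k - 1 / (k + 1)]. *)
  enough (0 <= nested_sum (S m) (S n) <= 1 - / INR (S n)) as Hn.
  { assert (0 < / INR (S n)) by (apply Rinv_0_lt_compat, lt_0_INR; lia).
    lra. }
  induction n as [|n IHn].
  { rewrite nested_sum_1; simpl; lra. }
  rewrite nested_sum_succ.
  specialize (IHm n).
  rewrite !S_INR in *; pose proof (pos_INR n) as Hx.
  set (x := INR n) in *.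
  assert (0 <= 1 / (2 * (x + 1)) ^ 2 * nested_sum m (S n)
            <= / (x + 1) - / (x + 1 + 1)) as Hs; [|lra].
  assert (0 < 1 / (2 * (x + 1)) ^ 2) as Hp.
  { apply Rdiv_lt_0_compat; [lra | apply pow_lt; lra]. }
  split; [apply Rmult_le_pos; lra|].
  apply Rle_trans with (1 / (2 * (x + 1)) ^ 2); [nra|].
  apply Rminus_le_0.
  replace (/ (x + 1) - / (x + 1 + 1) - 1 / (2 * (x + 1)) ^ 2)
    with ((3 * x + 2) / (4 * (x + 1) ^ 2 * (x + 2))) by (field; lra).
  apply Rlt_le, Rdiv_lt_0_compat; [lra|].
  apply Rmult_lt_0_compat; [apply Rmult_lt_0_compat, pow_lt|]; lra.
Qed.

Lemma central_binomial_pos (j : nat) : 0 < Binomial.C (2 * j) j.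
Proof.
  unfold Binomial.C; apply Rdiv_lt_0_compat;
    [|apply Rmult_lt_0_compat]; apply INR_fact_lt_0.
Qed.

Lemma central_binomial_succ (j : nat) :
  INR (S j) * Binomial.C (2 * S j) (S j) =
  2 * (2 * INR j + 1) * Binomial.C (2 * j) j.
Proof.
  unfold Binomial.C.
  replace (2 * S j - S j)%nat with (S j) by lia.
  replace (2 * j - j)%nat with j by lia.
  replace (2 * S j)%nat with (S (S (2 * j))) by lia.
  rewrite !fact_simpl, !mult_INR, !S_INR, mult_INR.
  pose proof (pos_INR j); pose proof (INR_fact_lt_0 j).
  simpl (INR 2); field; lra.
Qed.

(** For [x = j >= 1], passing from [j] to [j + 1] multiplies [j^2 C(2j,j)] by
    [2 (2x + 1) (x + 1) / x^2], which exceeds 4. This growth gives the power series below a radius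
    of convergence of at least 4. *)
Lemma square_central_binomial_lower_bound (j : nat) :
  4 ^ S j <= 4 * (INR (S j) ^ 2 * Binomial.C (2 * S j) (S j)).
Proof.
  assert (forall k, INR (S k) ^ 2 * Binomial.C (2 * S k) (S k) =
            2 * (2 * INR k + 1) * INR (S k) * Binomial.C (2 * k) k) as E.
  { intros k.
    transitivity (INR (S k) * (INR (S k) * Binomial.C (2 * S k) (S k)));
      [ring|]; rewrite central_binomial_succ; ring. }
  induction j as [|j IHj].
  { rewrite E; unfold Binomial.C; simpl; lra. }
  rewrite E.
  pose proof (central_binomial_pos (S j)) as Hc.
  pose proof (pos_INR j).
  set (c := Binomial.C (2 * S j) (S j)) in *.
  change (4 ^ S (S j)) with (4 * 4 ^ S j).
  rewrite (S_INR (S j)); rewrite !S_INR in *.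
  nra.
Qed.

(** * The power series of even powers of the arcsine *)

(** Level 0 is the constant series 1 instead of the junk value of [H 0], so that the recurrence
    linking levels [m] and [m + 1] already holds at [m = 0]. *)
Definition arcsin_coeff (m j : nat) : R :=
  match m with
  | O => match j with O => 1 | S _ => 0 end
  | S _ => coeff m j
  end.

(** The denominator of [coeff] is 0 at [j = 0], and the convention [/ 0 = 0] yields exactly the
    constant term required by [g_m(0) = 0]. *)
Lemma arcsin_coeff_0 (m : nat) : arcsin_coeff (S m) 0 = 0.
Proof.
  unfold arcsin_coeff, coeff, Rdiv.
  replace (INR 0 ^ 2 * _) with 0 by (simpl; ring).
  rewrite Rinv_0; ring.
Qed.

Lemma arcsin_coeff_bounded (m j : nat) : Rabs (arcsin_coeff m j * 4 ^ j) <= 1.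
Proof.
  destruct m as [|m].
  { destruct j; simpl; [rewrite Rabs_right | rewrite Rmult_0_l, Rabs_R0]; lra. }
  destruct j as [|j].
  { rewrite arcsin_coeff_0, Rmult_0_l, Rabs_R0; lra. }
  unfold arcsin_coeff, coeff, H.
  pose proof (nested_sum_bounds m j) as Hn.
  pose proof (square_central_binomial_lower_bound j) as Hd.
  assert (0 < 4 ^ S j) as Hp by (apply pow_lt; lra).
  set (d := INR (S j) ^ 2 * _) in *.
  set (p := 4 ^ S j) in *.
  set (v := nested_sum m (S j)) in *.
  replace (1 / 4 * v / d * p) with (v * (p / (4 * d))) by (field; lra).
  assert (0 <= p / (4 * d) <= 1) as Hq.
  { split; [apply Rlt_le, Rdiv_lt_0_compat; lra|].
    apply Rmult_le_reg_r with (4 * d); [lra|].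
    unfold Rdiv; rewrite Rmult_assoc, Rinv_l by lra; lra. }
  rewrite Rabs_pos_eq; nra.
Qed.

Lemma arcsin_coeff_radius (m : nat) (w : R) :
  0 <= w < 4 -> Rbar_lt (Rabs w) (CV_radius (arcsin_coeff m)).
Proof.
  intros Hw; rewrite Rabs_pos_eq by lra.
  apply Rbar_lt_le_trans with (Finite 4); [simpl; lra|].
  apply (proj1 (CV_radius_bounded (arcsin_coeff m))).
  exists 1; apply arcsin_coeff_bounded.
Qed.

(** For [j >= 1] both terms on the left are nested sums of depth [m] over [C(2j,j)], at [j + 1] and
    at [j]. Their difference is the outermost summand of index [j], which has depth [m - 1]; for
    [m = 0] it is 0. *)
Lemma arcsin_coeff_recurrence (m j : nat) :
  8 * INR (S j) * (2 * INR j + 1) * arcsin_coeff (S m) (S j)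
    - 4 * INR j ^ 2 * arcsin_coeff (S m) j = arcsin_coeff m j.
Proof.
  assert (8 * INR (S j) * (2 * INR j + 1) * arcsin_coeff (S m) (S j)
          = nested_sum m (S j) / Binomial.C (2 * j) j) as E1.
  { unfold arcsin_coeff, coeff, H.
    pose proof (central_binomial_succ j) as Hs.
    pose proof (central_binomial_pos j).
    pose proof (central_binomial_pos (S j)).
    assert (0 < INR (S j)) by (apply lt_0_INR; lia).
    set (c := Binomial.C (2 * j) j) in *.
    set (c' := Binomial.C (2 * S j) (S j)) in *.
    replace (8 * INR (S j) * (2 * INR j + 1) *
               (1 / 4 * nested_sum m (S j) / (INR (S j) ^ 2 * c')))
      with (2 * (2 * INR j + 1) * c * nested_sum m (S j) / (INR (S j) * c' * c))
      by (field; lra).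
    rewrite <- Hs; field; lra. }
  rewrite E1.
  destruct j as [|j].
  { replace (Binomial.C (2 * 0) 0) with 1 by (unfold Binomial.C; simpl; field).
    rewrite arcsin_coeff_0.
    destruct m as [|m]; [simpl; field|].
    rewrite nested_sum_1, arcsin_coeff_0; field. }
  unfold arcsin_coeff, coeff, H.
  pose proof (central_binomial_pos (S j)).
  assert (0 < INR (S j)) by (apply lt_0_INR; lia).
  destruct m as [|m].
  - cbn [nested_sum]; field; lra.
  - rewrite nested_sum_succ; field; lra.
Qed.

(** This is [g_(m+1)'' = g_m] written in [w]: for [w = 4 sin^2 t] one has [(w')^2 = 16 w - 4 w^2]
    and [w'' = 8 - 4 w]. Comparing coefficients of [w^j] leaves [arcsin_coeff_recurrence]. *)
Lemma arcsin_series_ode (m : nat) (w : R) : 0 <= w < 4 ->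
  (16 * w - 4 * w ^ 2) * PSeries (PS_derive (PS_derive (arcsin_coeff (S m)))) w
    + (8 - 4 * w) * PSeries (PS_derive (arcsin_coeff (S m))) w
  = PSeries (arcsin_coeff m) w.
Proof.
  intros Hw.
  pose proof (arcsin_coeff_radius (S m) w Hw) as Hr.
  set (c := arcsin_coeff (S m)) in *.
  set (d := PS_derive c); set (e := PS_derive d).
  assert (is_pseries d w (PSeries d w)) as Hd.
  { apply PSeries_correct, CV_radius_inside; unfold d.
    now rewrite CV_radius_derive. }
  assert (is_pseries e w (PSeries e w)) as He.
  { apply PSeries_correct, CV_radius_inside; unfold e, d.
    now rewrite !CV_radius_derive. }
  (* Index shifts realise multiplication by [w]: these are the series of [w y'], [w y''] and
     [w^2 y'']. *)
  pose proof (is_pseries_incr_1 _ _ _ Hd) as Hd1.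
  pose proof (is_pseries_incr_1 _ _ _ He) as He1.
  pose proof (is_pseries_incr_1 _ _ _ He1) as He2.
  pose proof (fun k a l => is_pseries_scal (V := R_NormedModule) k a w l
                (Rmult_comm w k)) as Hk.
  pose proof (is_pseries_plus _ _ _ _ _
    (is_pseries_plus _ _ _ _ _ (Hk 16 _ _ He1) (Hk (-4) _ _ He2))
    (is_pseries_plus _ _ _ _ _ (Hk 8 _ _ Hd) (Hk (-4) _ _ Hd1))) as Hsum.
  apply is_pseries_unique in Hsum.
  unfold plus, scal in Hsum; simpl in Hsum.
  unfold mult in Hsum; simpl in Hsum.
  transitivity (16 * (w * PSeries e w) + -4 * (w * (w * PSeries e w)) +
    (8 * PSeries d w + -4 * (w * PSeries d w))); [ring|].
  rewrite <- Hsum; apply PSeries_ext; intros n.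
  rewrite <- (arcsin_coeff_recurrence m n); fold c.
  unfold PS_plus, PS_scal, plus, scal; simpl; unfold mult; simpl.
  (* The double shift in [w^2 y''] makes the coefficients of index 0 and 1 special. *)
  destruct n as [|[|n]]; unfold PS_incr_1, e, d, PS_derive, zero; simpl;
    ring.
Qed.

(** * Passage to the angle [t] and double integration *)

Lemma arcsin_series_comp_derive (a : nat -> R) (t : R) :
  Rbar_lt (Rabs (4 * sin t ^ 2)) (CV_radius a) ->
  is_derive (fun u => PSeries a (4 * sin u ^ 2)) t
    (8 * sin t * cos t * PSeries (PS_derive a) (4 * sin t ^ 2)).
Proof.
  intros Hr.
  apply (is_derive_comp (PSeries a) (fun u => 4 * sin u ^ 2)).
  - now apply is_derive_PSeries.
  - auto_derive; [easy | ring].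
Qed.

Lemma four_sin_sqr_bounds (t : R) : 0 <= t < PI / 2 -> 0 <= 4 * sin t ^ 2 < 4.
Proof.
  intros Ht.
  assert (0 < cos t) by (apply cos_gt_0; lra).
  pose proof (sin2_cos2 t) as E; unfold Rsqr in E; nra.
Qed.

Lemma is_derive_pow_fact (n : nat) (t : R) :
  is_derive (fun u => u ^ S n / INR (fact (S n))) t (t ^ n / INR (fact n)).
Proof.
  pose proof (INR_fact_lt_0 n); pose proof (pos_INR n).
  assert (INR (fact (S n)) = INR (S n) * INR (fact n)) as E
    by now rewrite fact_simpl, mult_INR.
  pose proof (INR_fact_neq_0 (S n)); set (k := INR (fact (S n))) in *.
  auto_derive; [easy|].
  change (match n with 0%nat => 1 | S _ => INR n + 1 end) with (INR (S n)).
  rewrite E, S_INR; simpl; field; lra.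
Qed.

Lemma eq_of_derive_eq (f g df : R -> R) (b : R) :
  f 0 = g 0 ->
  (forall t, 0 <= t < b -> is_derive f t (df t)) ->
  (forall t, 0 <= t < b -> is_derive g t (df t)) ->
  forall t, 0 <= t < b -> f t = g t.
Proof.
  intros E0 Hf Hg t Ht.
  destruct (Req_dec t 0) as [->|Ht0]; [easy|].
  assert (f 0 - g 0 = f t - g t) as E; [|lra].
  apply (eq_is_derive (fun u => f u - g u)); [|lra].
  intros u Hu.
  assert (0 <= u < b) as Hub by lra.
  pose proof (is_derive_minus f g u _ _ (Hf u Hub) (Hg u Hub)) as Hd.
  rewrite minus_eq_zero in Hd; exact Hd.
Qed.

Lemma PSeries_arcsin_coeff (m : nat) (t : R) : 0 <= t < PI / 2 ->
  PSeries (arcsin_coeff m) (4 * sin t ^ 2) = t ^ (2 * m) / INR (fact (2 * m)).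
Proof.
  revert t; induction m as [|m IHm].
  { intros t Ht; rewrite PSeries_decr_1.
    - rewrite (PSeries_ext _ (fun _ => 0)) by easy.
      rewrite PSeries_const_0; simpl; field.
    - now apply CV_radius_inside, arcsin_coeff_radius, four_sin_sqr_bounds. }
  set (c := arcsin_coeff (S m)).
  replace (2 * S m)%nat with (S (S (2 * m))) by lia.
  assert (forall t, 0 <= t < PI / 2 ->
    Rbar_lt (Rabs (4 * sin t ^ 2)) (CV_radius c)) as Hr.
  { intros t Ht; now apply arcsin_coeff_radius, four_sin_sqr_bounds. }
  (* First integration: both sides vanish at 0, so it suffices to compare first derivatives. *)
  apply eq_of_derive_eq with
    (df := fun t => 8 * sin t * cos t * PSeries (PS_derive c) (4 * sin t ^ 2)).
  - rewrite sin_0, !pow_i by lia; rewrite Rmult_0_r, PSeries_0; unfold c.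
    rewrite arcsin_coeff_0; field; apply INR_fact_neq_0.
  - intros t Ht; now apply arcsin_series_comp_derive, Hr.
  - intros t Ht.
    replace (8 * _ * _ * _) with (t ^ S (2 * m) / INR (fact (S (2 * m))));
      [apply is_derive_pow_fact|].
    symmetry; revert t Ht.
    (* Second integration: the first derivatives vanish at 0 as well, and the second derivatives are
       known from [IHm]. *)
    apply eq_of_derive_eq with (df := fun t => t ^ (2 * m) / INR (fact (2 * m))).
    + rewrite sin_0, !pow_i by lia; field; apply INR_fact_neq_0.
    + intros t Ht.
      pose proof (arcsin_series_comp_derive (PS_derive c) t) as Hd.
      rewrite CV_radius_derive in Hd; specialize (Hd (Hr t Ht)).
      assert (is_derive (fun u => 8 * sin u * cos u) t
        (8 * cos t ^ 2 - 8 * sin t ^ 2)) as Hs.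
      { auto_derive; [easy | ring]. }
      pose proof (is_derive_mult _ _ t _ _ Hs Hd Rmult_comm) as Hm.
      rewrite <- (IHm t Ht).
      rewrite <- (arcsin_series_ode m _ (four_sin_sqr_bounds t Ht)); fold c.
      assert (cos t ^ 2 = 1 - sin t ^ 2) as E.
      { rewrite <- !Rsqr_pow2; apply cos2. }
      (* The product rule has produced [(w')^2 y'' + w'' y']; [cos^2 = 1 - sin^2] turns it into the
         left side of the differential equation. *)
      eapply eq_ind; [exact Hm|].
      unfold plus, mult; cbn -[pow PSeries].
      ring [E].
    + intros t Ht; apply is_derive_pow_fact.
Qed.

Lemma is_series_coeff (m : nat) (t : R) : (1 <= m)%nat -> 0 <= t < PI / 2 ->
  is_series (fun n => coeff m (S n) * (4 * sin t ^ 2) ^ S n)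
    (t ^ (2 * m) / INR (fact (2 * m))).
Proof.
  intros Hm Ht; destruct m as [|m]; [lia|].
  pose proof (four_sin_sqr_bounds t Ht) as Hw.
  rewrite <- (PSeries_arcsin_coeff _ t Ht).
  pose proof (PSeries_correct _ _
    (CV_radius_inside _ _ (arcsin_coeff_radius (S m) _ Hw))) as Hs.
  apply is_pseries_R in Hs.
  apply (is_series_incr_1
    (fun n => arcsin_coeff (S m) n * (4 * sin t ^ 2) ^ n)).
  rewrite arcsin_coeff_0, Rmult_0_l.
  replace (plus _ _) with (PSeries (arcsin_coeff (S m)) (4 * sin t ^ 2));
    [exact Hs | unfold plus; simpl; ring].
Qed.

(** * Binet's formulas and the golden angles *)

Definition beta : R := (1 - sqrt 5) / 2.

Lemma sqrt5_sqr : sqrt 5 * sqrt 5 = 5.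
Proof. apply sqrt_sqrt; lra. Qed.

Lemma sqrt5_bounds : 2 < sqrt 5 < 3.
Proof.
  pose proof (sqrt_pos 5); pose proof sqrt5_sqr; split; nra.
Qed.

Lemma alpha_sqr : alpha * alpha = alpha + 1.
Proof. unfold alpha; pose proof sqrt5_sqr; nra. Qed.

Lemma beta_sqr : beta * beta = beta + 1.
Proof. unfold beta; pose proof sqrt5_sqr; nra. Qed.

Lemma alpha_mul_beta : alpha * beta = -1.
Proof. unfold alpha, beta; pose proof sqrt5_sqr; nra. Qed.

Lemma alpha_neq_0 : alpha <> 0.
Proof. unfold alpha; pose proof sqrt5_bounds; lra. Qed.

Lemma beta_neq_0 : beta <> 0.
Proof. unfold beta; pose proof sqrt5_bounds; lra. Qed.

Lemma fib_binet (n : nat) : IZR (fib n) = (alpha ^ n - beta ^ n) / sqrt 5.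
Proof.
  pose proof sqrt5_bounds.
  enough (IZR (fib n) = (alpha ^ n - beta ^ n) / sqrt 5 /\
    IZR (fib (S n)) = (alpha ^ S n - beta ^ S n) / sqrt 5) by easy.
  induction n as [|n [IH1 IH2]].
  { simpl; split; [|unfold alpha, beta]; field; lra. }
  split; [easy|].
  change (fib (S (S n))) with (fib (S n) + fib n)%Z.
  rewrite plus_IZR, IH1, IH2; simpl.
  rewrite <- !(Rmult_assoc alpha), <- !(Rmult_assoc beta), alpha_sqr, beta_sqr.
  field; lra.
Qed.

Lemma luc_binet (n : nat) : IZR (luc n) = alpha ^ n + beta ^ n.
Proof.
  enough (IZR (luc n) = alpha ^ n + beta ^ n /\
    IZR (luc (S n)) = alpha ^ S n + beta ^ S n) by easy.
  induction n as [|n [IH1 IH2]].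
  { simpl; unfold alpha, beta; split; field. }
  split; [easy|].
  change (luc (S (S n))) with (luc (S n) + luc n)%Z.
  rewrite plus_IZR, IH1, IH2; simpl.
  rewrite <- !(Rmult_assoc alpha), <- !(Rmult_assoc beta), alpha_sqr, beta_sqr.
  ring.
Qed.

(** Since [alpha * beta = -1], inversion swaps the two roots up to sign; this extends Binet's
    formulas to negative indices. *)
Lemma alpha_pow_inv (n : nat) : / alpha ^ n = (-1) ^ n * beta ^ n.
Proof.
  rewrite <- Rpow_mult_distr, <- pow_inv; f_equal.
  pose proof alpha_mul_beta; pose proof alpha_neq_0.
  apply Rmult_eq_reg_l with alpha; [rewrite Rinv_r|]; lra.
Qed.

Lemma beta_pow_inv (n : nat) : / beta ^ n = (-1) ^ n * alpha ^ n.
Proof.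
  rewrite <- Rpow_mult_distr, <- pow_inv; f_equal.
  pose proof alpha_mul_beta; pose proof beta_neq_0.
  apply Rmult_eq_reg_l with beta; [rewrite Rinv_r|]; lra.
Qed.

Lemma IZR_opp1_pow (n : nat) : IZR ((-1) ^ Z.of_nat n) = (-1) ^ n.
Proof. symmetry; apply pow_IZR. Qed.

Lemma fibZ_binet (j : Z) :
  IZR (fibZ j) = (powerRZ alpha j - powerRZ beta j) / sqrt 5.
Proof.
  destruct j as [|p|p].
  - simpl; unfold Rdiv; ring.
  - apply fib_binet.
  - unfold fibZ; rewrite mult_IZR, fib_binet; simpl powerRZ.
    rewrite alpha_pow_inv, beta_pow_inv.
    (* Swapping the roots negates their difference, which turns [(-1)^p] into the sign [(-1)^(p-1)]
       of the definition. *)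
    replace (Z.pos p - 1)%Z with (Z.of_nat (pred (Pos.to_nat p))) by lia.
    rewrite IZR_opp1_pow.
    pose proof (Pos2Nat.is_pos p).
    destruct (Pos.to_nat p) as [|n]; [lia|].
    simpl pred; simpl ((-1) ^ S n); pose proof sqrt5_bounds; field; lra.
Qed.

Lemma lucZ_binet (j : Z) : IZR (lucZ j) = powerRZ alpha j + powerRZ beta j.
Proof.
  destruct j as [|p|p].
  - simpl; ring.
  - apply luc_binet.
  - unfold lucZ; rewrite mult_IZR, luc_binet; simpl powerRZ.
    rewrite alpha_pow_inv, beta_pow_inv.
    rewrite <- (positive_nat_Z p), IZR_opp1_pow; ring.
Qed.

Lemma powerRZ_double_add (x : R) (n : nat) (s : Z) : x <> 0 ->
  powerRZ x (2 * Z.of_nat n + s) = (x ^ 2) ^ n * powerRZ x s.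
Proof.
  intros Hx; rewrite powerRZ_add by easy; f_equal.
  rewrite <- pow_mult, pow_powerRZ; f_equal; lia.
Qed.

(* [cos (3 a) = sin (2 a)] at [a = PI / 10] is a quadratic equation for [sin a]. *)
Lemma sin_pi_10 : 2 * sin (PI / 10) = - beta.
Proof.
  pose proof PI_RGT_0.
  set (a := PI / 10).
  assert (0 < cos a) as Hc by (apply cos_gt_0; unfold a; lra).
  assert (0 < sin a) as Hs by (apply sin_gt_0; unfold a; lra).
  assert (cos (2 * a + a) = sin (2 * a)) as E.
  { rewrite <- cos_shift; f_equal; unfold a; field. }
  rewrite cos_plus, cos_2a_sin, sin_2a in E.
  assert (4 * sin a * sin a + 2 * sin a - 1 = 0) as Hq.
  { apply Rmult_eq_reg_l with (cos a); nra. }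
  unfold beta; pose proof sqrt5_sqr; pose proof sqrt5_bounds.
  (* Four times the quadratic, factored; the second factor is positive because [sin a > 0]. *)
  assert ((4 * sin a + 1 - sqrt 5) * (4 * sin a + 1 + sqrt 5) = 0) as Hf by nra.
  apply Rmult_integral in Hf; destruct Hf; lra.
Qed.

(** By the complementary angle the left side is [2 cos (PI / 5) = 2 - 4 sin^2 (PI / 10) = 2 - beta^2
    = 1 - beta]. *)
Lemma sin_3pi_10 : 2 * sin (3 * (PI / 10)) = alpha.
Proof.
  replace (3 * (PI / 10)) with (PI / 2 - 2 * (PI / 10)) by field.
  rewrite sin_shift, cos_2a_sin.
  pose proof sin_pi_10; pose proof beta_sqr.
  replace alpha with (1 - beta) by (unfold alpha, beta; field).
  nra.
Qed.

Lemma is_series_coeff_alpha (m : nat) : (1 <= m)%nat ->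
  is_series (fun n => coeff m (S n) * (alpha ^ 2) ^ S n)
    (3 ^ (2 * m) * (1 / INR (fact (2 * m)) * (PI / 10) ^ (2 * m))).
Proof.
  intros Hm; pose proof PI_RGT_0.
  assert (0 <= 3 * (PI / 10) < PI / 2) as Ht by lra.
  pose proof (is_series_coeff m _ Hm Ht) as Hs.
  replace (4 * sin (3 * (PI / 10)) ^ 2) with (alpha ^ 2) in Hs
    by (rewrite <- sin_3pi_10; ring).
  rewrite Rpow_mult_distr in Hs.
  replace (3 ^ (2 * m) * _) with
    (3 ^ (2 * m) * (PI / 10) ^ (2 * m) / INR (fact (2 * m))); [exact Hs|].
  field; apply INR_fact_neq_0.
Qed.

Lemma is_series_coeff_beta (m : nat) : (1 <= m)%nat ->
  is_series (fun n => coeff m (S n) * (beta ^ 2) ^ S n)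
    (1 / INR (fact (2 * m)) * (PI / 10) ^ (2 * m)).
Proof.
  intros Hm; pose proof PI_RGT_0.
  assert (0 <= PI / 10 < PI / 2) as Ht by lra.
  pose proof (is_series_coeff m _ Hm Ht) as Hs.
  replace (4 * sin (PI / 10) ^ 2) with (beta ^ 2) in Hs.
  2:{ replace beta with (- (2 * sin (PI / 10))) by (rewrite sin_pi_10; ring).
      ring. }
  replace (1 / _ * _) with ((PI / 10) ^ (2 * m) / INR (fact (2 * m)));
    [exact Hs|].
  field; apply INR_fact_neq_0.
Qed.

Lemma is_series_lin_comb (p q : R) (a b : nat -> R) (la lb : R) :
  is_series a la -> is_series b lb ->
  is_series (fun n => p * a n + q * b n) (p * la + q * lb).
Proof.
  intros Ha Hb.
  apply (is_series_plus (fun n => p * a n) (fun n => q * b n));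
    now apply (is_series_scal (V := R_NormedModule)).
Qed.

(* The series over j >= 1 are indexed by n : nat with j = S n. *)
Theorem theorem6 (s : Z) (m : nat) (hm : (1 <= m)%nat) :
  is_series
    (fun n : nat => coeff m (S n) * IZR (fibZ (2 * Z.of_nat (S n) + s)))
    (1 / INR (fact (2 * m)) * (PI / 10) ^ (2 * m) * (1 / sqrt 5)
      * ((3 ^ (2 * m) + 1) * powerRZ alpha s - IZR (lucZ s)))
  /\
  is_series
    (fun n : nat => coeff m (S n) * IZR (lucZ (2 * Z.of_nat (S n) + s)))
    (1 / INR (fact (2 * m)) * (PI / 10) ^ (2 * m)
      * ((3 ^ (2 * m) - 1) * powerRZ alpha s + IZR (lucZ s))).
Proof.
  pose proof (is_series_coeff_alpha m hm) as Ha.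
  pose proof (is_series_coeff_beta m hm) as Hb.
  pose proof sqrt5_bounds.
  pose proof alpha_neq_0; pose proof beta_neq_0.
  set (K := 1 / INR (fact (2 * m)) * (PI / 10) ^ (2 * m)) in *.
  rewrite lucZ_binet; split.
  (* The weights come from Binet's formula. As [L_s = alpha^s + beta^s], the value
     [3^(2m) alpha^s - beta^s] equals [(3^(2m) + 1) alpha^s - L_s]. *)
  - pose proof (is_series_lin_comb (powerRZ alpha s / sqrt 5)
      (- powerRZ beta s / sqrt 5) _ _ _ _ Ha Hb) as Hs.
    match type of Hs with is_series _ ?x =>
      match goal with |- is_series _ ?y => replace y with x end end.
    2:{ field; lra. }
    revert Hs; apply is_series_ext; intros n; apply Rminus_diag_uniq.
    rewrite fibZ_binet, !powerRZ_double_add by easy; field; lra.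
  (* Likewise [3^(2m) alpha^s + beta^s = (3^(2m) - 1) alpha^s + L_s]. *)
  - pose proof (is_series_lin_comb (powerRZ alpha s) (powerRZ beta s)
      _ _ _ _ Ha Hb) as Hs.
    match type of Hs with is_series _ ?x =>
      match goal with |- is_series _ ?y => replace y with x by ring end end.
    revert Hs; apply is_series_ext; intros n; apply Rminus_diag_uniq.
    rewrite lucZ_binet, !powerRZ_double_add by easy; ring.
Qed.
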